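(* Let $r<s$ and $m,x$ be positive integers and $q=(r^m,s^x)$ ($m$ copies of $r$ followed by $x$ copies of $s$). If $\Delta_{(1,q)}$ is reflexive and has the integer decomposition property, then its $h^\ast$-polynomial is unimodal.
   Context: For $q=(q_1,\ldots,q_n)$, $\Delta_{(1,q)}:=\operatorname{conv}\{e_1,\ldots,e_n,-\sum_i q_ie_i\}\subset\mathbb{R}^n$. A lattice polytope containing $0$ in its interior is reflexive if its polar is a lattice polytope. A lattice polytope $P\subset\mathbb{R}^n$ has the integer decomposition property if for every positive integer $k$ and every $w\in kP\cap\mathbb{Z}^n$ there exist $x_1,\ldots,x_k\in P\cap\mathbb{Z}^n$ with $w=x_1+\cdots+x_k$. The $h^\ast$-polynomial $h^\ast(P;z)=\sum_{i=0}^d h_i^\ast z^i$ of a $d$-dimensional lattice polytope is defined by $\sum_{t\ge0}|tP\cap\mathbb{Z}^n|z^t=h^\ast(P;z)/(1-z)^{d+1}$. A polynomial $a_0+\cdots+a_dz^d$ is unimodal if there is $j$ with $a_i\le a_{i+1}$ for $i<j$ and $a_i\ge a_{i+1}$ for $i\ge j$. *)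

(* Defs.v *)
From mathcomp Require Import all_boot all_order all_algebra finmap.
From mathcomp Require Import all_classical all_reals topology normedtype.

Set Implicit Arguments.
Unset Strict Implicit.
Unset Printing Implicit Defensive.

Import Order.TTheory GRing.Theory Num.Theory.
Import numFieldNormedType.Exports.
Local Open Scope classical_set_scope.
Local Open Scope ring_scope.

Section Polytopes.
Variables (R : realType) (n : nat).
Implicit Types (A P : set 'rV[R]_n) (x y p : 'rV[R]_n).

Definition conv_hull A : set 'rV[R]_n :=
  [set x | exists (k : nat) (v : 'I_k -> 'rV[R]_n) (c : 'I_k -> R),
    [/\ forall i, A (v i), forall i, 0 <= c i, \sum_i c i = 1
      & x = \sum_i c i *: v i]].

Definition lattice : set 'rV[R]_n := [set x | forall i, x 0 i \is a Num.int].

Definition lattice_polytope P : Prop :=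
  exists V : seq 'rV[R]_n, [set` V] `<=` lattice /\ P = conv_hull [set` V].

Definition polar P : set 'rV[R]_n :=
  [set y | forall x, P x -> \sum_i x 0 i * y 0 i <= 1].

Definition reflexive_polytope P : Prop :=
  [/\ lattice_polytope P, interior P 0 & lattice_polytope (polar P)].

Definition dilate (t : nat) P : set 'rV[R]_n := [set t%:R *: x | x in P].

Definition has_IDP P : Prop :=
  lattice_polytope P /\
  forall (k : nat) (w : 'rV[R]_n), (0 < k)%N ->
    (dilate k P `&` lattice) w ->
    exists v : 'I_k -> 'rV[R]_n,
      (forall i, (P `&` lattice) (v i)) /\ w = \sum_i v i.

(* fset_set is the empty fset on infinite sets; a polytope has only finitely
   many lattice points in each dilate. *)
Definition ehrhart P (t : nat) : nat := #|` fset_set (dilate t P `&` lattice)|.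

(* The affine hull of P is p + (row space of B), with B of rank d. *)
Definition has_dim P (d : nat) : Prop :=
  exists (p : 'rV[R]_n) (B : 'M[R]_(d, n)),
    [/\ P p, row_free B, forall i, P (p + row i B)
      & forall x, P x -> (x - p <= B)%MS].

Lemma has_dim_uniq P d1 d2 : has_dim P d1 -> has_dim P d2 -> d1 = d2.
Proof.
have le e1 e2 : has_dim P e1 -> has_dim P e2 -> (e1 <= e2)%N.
  move=> [p [B [Pp /eqP rB PB _]]] [p' [B' [_ /eqP rB' _ P'B]]].
  rewrite -rB -rB'; apply: mxrankS; apply/row_subP => i.
  have -> : row i B = (p + row i B - p') - (p - p').
    by rewrite opprB addrA subrK [p + _]addrC addrK.
  by rewrite addmx_sub ?eqmx_opp ?P'B.
by move=> h1 h2; apply/eqP; rewrite eqn_leq !le.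
Qed.

End Polytopes.

Definition cauchy_product (a b : nat -> int) (k : nat) : int :=
  \sum_(i < k.+1) a i * b (k - i)%N.

(* The identity of formal power series
   (1 - z)^(d+1) * \sum_t |tP \cap Z^n| z^t = h(z), with d = dim P,
   coefficient by coefficient. *)
Definition is_hstar (R : realType) (n : nat) (P : set 'rV[R]_n)
    (h : {poly int}) : Prop :=
  exists d : nat,
    [/\ has_dim P d, (size h <= d.+1)%N
      & forall k : nat, h`_k =
          cauchy_product (fun i => ((1 - 'X : {poly int}) ^+ d.+1)`_i)
                         (fun t => (ehrhart P t)%:Z) k].

Lemma is_hstar_uniq (R : realType) (n : nat) (P : set 'rV[R]_n) h1 h2 :
  is_hstar P h1 -> is_hstar P h2 -> h1 = h2.
Proof.
move=> [d1 [D1 _ H1]] [d2 [D2 _ H2]]; apply/polyP => k.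
by rewrite H1 H2 (has_dim_uniq D1 D2).
Qed.

Definition unimodal (a : {poly int}) : Prop :=
  exists j : nat, forall i : nat, (i.+1 < size a)%N ->
    ((i < j)%N -> a`_i <= a`_i.+1) /\ ((j <= i)%N -> a`_i.+1 <= a`_i).

Definition Delta (R : realType) (n : nat) (q : n.-tuple nat) :
    set 'rV[R]_n :=
  conv_hull ([set delta_mx 0 i | i in [set: 'I_n]] `|`
             [set - \sum_i (tnth q i)%:R *: delta_mx 0 i]).
Arguments Delta R [n] q.

(* Main.v *)
Require Import Defs.
From mathcomp Require Import all_boot all_order all_algebra.
From mathcomp Require Import all_classical all_reals topology normedtype.
From mathcomp Require Import finmap zify ring.

(** Put Q = 1 + \sum_i q_i and w(N) = N - \sum_i floor(q_i N / Q).  The lattice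
    points of t Delta are the points u_i - floor(q_i N / Q) with N and the u_i
    natural numbers and \sum_i u_i + w(N) = t; as w(a Q + b) = a + w(b), this
    yields h^* = \sum_(b < Q) z^(w(b)).

    Reflexivity forces q_j | Q, because the polar has the vertex with
    coordinates 1 off j and 1 - Q / q_j at j.  Put l = Q / q_j and decompose
    the lattice point with N = l and u = 0, which has height w(l): the
    parameters N of the summands add up to l, and the j-th coordinate -1 forces
    one of them to be l itself, so w(l) = 1 by IDP.  For q = (r^m, s^x) these
    equations read s = 1 + m r and 1 + x (s mod r) = r, hence r = 1 or
    r = 1 + x.  In both cases h^*_(k+1) - h^*_k is a constant multiple of
    [k < m] + [k < x] - 1, so the peak is at max(m, x). *)

Set Implicit Arguments.
Unset Strict Implicit.
Unset Printing Implicit Defensive.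

Import Order.TTheory GRing.Theory Num.Theory.

(** * Arithmetic of the weight function *)

Definition vol n (q : n.-tuple nat) : nat := (\sum_i tnth q i).+1.

(** The truncated subtraction loses nothing, by [sum_div_le]. *)
Definition wt n (q : n.-tuple nat) (N : nat) : nat :=
  N - \sum_i (tnth q i * N) %/ vol q.

(** Add the Euclidean divisions of q_i N by Q over all i and use \sum_i q_i = Q - 1. *)
Lemma vol_mul_sum_div n (q : n.-tuple nat) (N : nat) :
  vol q * (\sum_i (tnth q i * N) %/ vol q) + (N + \sum_i (tnth q i * N) %% vol q)
    = vol q * N.
Proof.
rewrite addnCA big_distrr -big_split /=.
under eq_bigr do rewrite mulnC -divn_eq.
by rewrite -big_distrl /= /vol mulSn.
Qed.

Lemma sum_div_le n (q : n.-tuple nat) (N : nat) :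
  \sum_i (tnth q i * N) %/ vol q <= N.
Proof.
by rewrite -(@leq_pmul2l (vol q)) // -[leqRHS]vol_mul_sum_div leq_addr.
Qed.

Lemma sum_div_wt n (q : n.-tuple nat) (N : nat) :
  \sum_i (tnth q i * N) %/ vol q + wt q N = N.
Proof. by rewrite subnKC ?sum_div_le. Qed.

Lemma vol_mul_wt n (q : n.-tuple nat) (N : nat) :
  vol q * wt q N = N + \sum_i (tnth q i * N) %% vol q.
Proof. by rewrite mulnBr -[X in X - _]vol_mul_sum_div addKn. Qed.

Lemma wt_gt0 n (q : n.-tuple nat) (N : nat) : 0 < N -> 0 < wt q N.
Proof.
move=> N_gt0; rewrite -(@ltn_pmul2l (vol q)) // muln0 vol_mul_wt.
by rewrite ltn_addr.
Qed.

(** By [vol_mul_wt], Q w(b) is a sum of n + 1 numbers below Q. This bounds the degree of h^*. *)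
Lemma wt_le n (q : n.-tuple nat) (b : nat) : b < vol q -> wt q b <= n.
Proof.
move=> b_lt; rewrite -ltnS -(@ltn_pmul2l (vol q)) // vol_mul_wt mulnS.
rewrite -addSn leq_add // (@leq_trans (\sum_(i < n) vol q)) //.
  by apply: leq_sum => i _; rewrite ltnW // ltn_mod.
by rewrite sum_nat_const card_ord mulnC.
Qed.

(** Adding a Q to the argument raises the i-th floor by a q_i, hence their sum by a (Q - 1). *)
Lemma wt_vol_add n (q : n.-tuple nat) (a b : nat) :
  wt q (a * vol q + b) = a + wt q b.
Proof.
apply: (@addnI (\sum_i (tnth q i * (a * vol q + b)) %/ vol q)).
rewrite sum_div_wt; under eq_bigr do rewrite mulnDr mulnA divnMDl //.
rewrite big_split /= -big_distrl /= addnACA sum_div_wt.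
by rewrite /vol mulnS mulnC [(a + _)%N]addnC.
Qed.

(** * Facet inequalities of the simplex and its dilates *)

Local Open Scope classical_set_scope.
Local Open Scope ring_scope.

Lemma conv_hull_affine_ge0 (R : realType) n (A : set 'rV[R]_n) (c : R)
    (a : 'I_n -> R) :
  (forall v, A v -> 0 <= c + \sum_i v 0 i * a i) ->
  forall v, conv_hull A v -> 0 <= c + \sum_i v 0 i * a i.
Proof.
move=> A_ge0 _ [k [v [d [Av d_ge0 d_sum ->]]]].
have -> : c + \sum_i (\sum_k d k *: v k) 0 i * a i
    = \sum_k d k * (c + \sum_i v k 0 i * a i).
  under [RHS]eq_bigr do rewrite mulrDr mulr_sumr.
  rewrite big_split /= -mulr_suml d_sum mul1r exchange_big /=.
  congr (_ + _); apply: eq_bigr => i _.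
  rewrite summxE mulr_suml; apply: eq_bigr => l _.
  by rewrite mxE mulrA.
by apply: sumr_ge0 => i _; rewrite mulr_ge0 // A_ge0.
Qed.

Lemma sub_conv_hull (R : realType) n (A : set 'rV[R]_n) : A `<=` conv_hull A.
Proof.
move=> v Av; exists 1%N, (fun=> v), (fun=> 1).
by split=> //; rewrite big_ord1 // scale1r.
Qed.

Lemma Delta_vertexP (R : realType) n (q : n.-tuple nat) (P : 'rV[R]_n -> Prop) :
  (forall i, P (delta_mx 0 i)) -> P (\row_i - (tnth q i)%:R) ->
  forall v, ([set delta_mx 0 i | i in [set: 'I_n]] `|`
    [set - \sum_i (tnth q i)%:R *: delta_mx 0 i]) v -> P v.
Proof.
move=> Pd Pq v [[i _ <-] //|->]; suff <- : \row_i - (tnth q i)%:R =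
  - \sum_i (tnth q i)%:R *: delta_mx 0 i :> 'rV[R]_n by [].
apply/rowP => i; rewrite !mxE summxE (bigD1 i) //= !mxE !eqxx mulr1.
by rewrite big1 ?addr0 // => j ji; rewrite !mxE eq_sym (negbTE ji) mulr0.
Qed.

Lemma sum_delta_mx (R : realType) n (i : 'I_n) (a : 'I_n -> R) :
  \sum_j (delta_mx 0 i : 'rV[R]_n) 0 j * a j = a i.
Proof.
rewrite (bigD1 i) //= !mxE !eqxx mul1r big1 ?addr0 // => j ji.
by rewrite mxE (negbTE ji) mul0r.
Qed.

(** Up to the factor Q, the inequalities say that the barycentric coordinates are nonnegative: l0 =
    (1 - \sum_i v_i) / Q at the vertex -q and v_i + q_i l0 at e_i. *)
Lemma DeltaP (R : realType) n (q : n.-tuple nat) (v : 'rV[R]_n) :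
  Delta R q v <-> \sum_i v 0 i <= 1 /\
    forall i, 0 <= (vol q)%:R * v 0 i + (tnth q i)%:R * (1 - \sum_i v 0 i).
Proof.
split=> [Dv|[sum_le ge]].
  split=> [|i].
    suff: 0 <= 1 + \sum_i v 0 i * -1 by rewrite -mulr_suml mulrN1 subr_ge0.
    apply: conv_hull_affine_ge0 Dv; apply: Delta_vertexP => [i|].
      by rewrite (sum_delta_mx i (fun=> -1)) subrr.
    by apply: addr_ge0 => //; apply: sumr_ge0 => i _; rewrite mxE mulrN1 opprK.
  pose a j : R := (i == j)%:R * (vol q)%:R - (tnth q i)%:R.
  have aE (u : 'rV[R]_n) : \sum_j u 0 j * a j =
      (vol q)%:R * u 0 i - (tnth q i)%:R * \sum_j u 0 j.
    under eq_bigr do rewrite mulrBr.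
    rewrite sumrB (bigD1 i) //= big1 => [|j ji]; last first.
      by rewrite eq_sym (negbTE ji) mul0r mulr0.
    by rewrite eqxx mul1r addr0 mulrC -mulr_suml [X in _ - X]mulrC.
  rewrite mulrBr mulr1 addrCA -aE.
  apply: conv_hull_affine_ge0 Dv; apply: Delta_vertexP => [j|].
    have := sum_delta_mx j (fun=> 1 : R); rewrite -mulr_suml mulr1 aE => ->.
    by rewrite mulr1 addrC subrK mulr_ge0 // mxE.
  rewrite aE mxE; under eq_bigr do rewrite mxE.
  rewrite sumrN mulrN mulrN opprK addrCA addrC -[X in X + _ - _]mulr1 -mulrDr.
  by rewrite /vol -natr_sum -natr1 [1 + _]addrC mulrC subrr.
pose l0 : R := (1 - \sum_i v 0 i) / (vol q)%:R.
have V0 : (vol q)%:R != 0 :> R by rewrite pnatr_eq0.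
have l0E : l0 * (1 + \sum_i (tnth q i)%:R) = 1 - \sum_i v 0 i.
  by rewrite -natr_sum nat1r divfK.
pose w : 'rV[R]_n := \sum_i (tnth q i)%:R *: delta_mx 0 i.
pose u (i : 'I_n.+1) : 'rV[R]_n :=
  if unlift ord0 i is Some j then delta_mx 0 j else - w.
pose d (i : 'I_n.+1) : R :=
  if unlift ord0 i is Some j then v 0 j + l0 * (tnth q j)%:R else l0.
exists n.+1, u, d; split.
- move=> i; rewrite /u; case: unliftP => [j|] _; first by left; exists j.
  by right.
- have l0_ge0 : 0 <= l0 by rewrite divr_ge0 ?subr_ge0.
  move=> i; rewrite /d; case: unliftP => [j|] _ //.
  rewrite -(pmulr_rge0 _ (_ : 0 < (vol q)%:R)) ?ltr0n // mulrDr.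
  by rewrite mulrA [_ * l0]mulrC divfK // mulrC [X in _ + X]mulrC mulrC.
- rewrite big_ord_recl /d unlift_none.
  under eq_bigr do rewrite liftK.
  rewrite big_split /= -mulr_sumr addrCA -[X in X + l0 * _]mulr1 -mulrDr l0E.
  by rewrite addrC subrK.
- rewrite big_ord_recl /u /d unlift_none.
  under eq_bigr do rewrite liftK scalerDl.
  rewrite big_split /= -row_sum_delta scalerN addrCA.
  under eq_bigr do rewrite -scalerA.
  by rewrite -scaler_sumr addNr addr0.
Qed.

Lemma dilate_DeltaP (R : realType) n (q : n.-tuple nat) (t : nat)
    (v : 'rV[R]_n) :
  dilate t (Delta R q) v <-> \sum_i v 0 i <= t%:R /\
    forall i, 0 <= (vol q)%:R * v 0 i + (tnth q i)%:R * (t%:R - \sum_i v 0 i).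
Proof.
have scaleE (c : R) (w : 'rV[R]_n) : \sum_i (c *: w) 0 i = c * \sum_i w 0 i.
  by rewrite mulr_sumr; apply: eq_bigr => i _; rewrite mxE.
have V_gt0 : 0 < (vol q)%:R :> R by rewrite ltr0n.
split=> [[w /DeltaP [w_le w_ge] <-]|[v_le v_ge]].
  rewrite scaleE; split=> [|i]; first by rewrite ler_piMr.
  rewrite mxE; have := mulr_ge0 (ler0n R t) (w_ge i).
  by rewrite mulrDr mulrCA [X in _ + X]mulrCA mulrBr mulr1.
have [t0|t_gt0] := posnP t; last first.
  have tN0 : t%:R != 0 :> R by rewrite pnatr_eq0 -lt0n.
  have t_ge0 : 0 < t%:R^-1 :> R by rewrite invr_gt0 ltr0n.
  exists (t%:R^-1 *: v); last by rewrite scalerA divff // scale1r.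
  apply/DeltaP; rewrite scaleE; split=> [|i].
    by rewrite mulrC ler_pdivrMr ?ltr0n // mul1r.
  rewrite mxE -(pmulr_rge0 _ (_ : 0 < t%:R)) ?ltr0n // mulrDr.
  by rewrite mulrCA mulVKf // mulrCA mulrBr mulr1 mulVKf.
(* For t = 0 rescaling is impossible. The n slacks add up to Q S - (Q - 1) S = S <= 0, so all of
   them vanish, and v = 0. *)
pose S := \sum_i v 0 i; move: v_le v_ge; rewrite t0 -/S => S_le v_ge.
have sum0 : \sum_i ((vol q)%:R * v 0 i + (tnth q i)%:R * (0 - S)) = S.
  rewrite big_split /= -mulr_sumr -mulr_suml -/S sub0r mulrN -natr_sum.
  by rewrite -mulrBl -natrB // /vol subSnn mul1r.
have S0 : S = 0.
  by apply/eqP; rewrite eq_le S_le -sum0 sumr_ge0 // => i _; apply: v_ge.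
have v0 : v = 0.
  apply/rowP => i; rewrite mxE; apply/eqP.
  have /eqP : (vol q)%:R * v 0 i + (tnth q i)%:R * (0 - S) = 0.
    by apply: (psumr_eq0P _ (etrans sum0 S0)) => // j _; apply: v_ge.
  by rewrite S0 subrr mulr0 addr0 mulf_eq0 gt_eqF.
exists 0; last by rewrite v0 scaler0.
apply/DeltaP; split=> [|i].
  by rewrite big1 // => i _; rewrite mxE.
rewrite mxE mulr0 add0r big1 => [|j _]; last by rewrite mxE.
by rewrite subr0 mulr1.
Qed.

(** * Lattice points of the dilates *)

Definition lpoint (R : realType) n (q : n.-tuple nat) (N : nat)
    (u : 'I_n -> nat) : 'rV[R]_n :=
  \row_i ((u i)%:R - ((tnth q i * N) %/ vol q)%N%:R).

Lemma lpointE (R : realType) n (q : n.-tuple nat) (N : nat) (u : 'I_n -> nat)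
    (i : 'I_n) :
  lpoint R q N u 0 i = (u i)%:R - ((tnth q i * N) %/ vol q)%N%:R.
Proof. by rewrite mxE. Qed.

Lemma sum_lpoint (R : realType) n (q : n.-tuple nat) (N t : nat)
    (u : 'I_n -> nat) :
  (\sum_i u i + wt q N = t)%N ->
  \sum_i lpoint R q N u 0 i = t%:R - N%:R.
Proof.
move=> <-; rewrite (eq_bigr _ (fun i _ => lpointE R q N u i)).
rewrite sumrB -!natr_sum -[X in _ = _ - X%:R](sum_div_wt q N) !natrD.
by rewrite opprD addrACA addrA addrK.
Qed.

(** Take N = t - \sum_i v_i, which is nonnegative by the first inequality. For integral v_i the i-th
    inequality v_i >= - q_i N / Q means that u_i = v_i + floor(q_i N / Q) is nonnegative. *)
Lemma dilate_Delta_latticeP (R : realType) n (q : n.-tuple nat) (t : nat)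
    (v : 'rV[R]_n) :
  (dilate t (Delta R q) `&` lattice (R := R) (n := n)) v <->
  exists (N : nat) (u : 'I_n -> nat),
    v = lpoint R q N u /\ (\sum_i u i + wt q N = t)%N.
Proof.
split=> [[/dilate_DeltaP [v_le v_ge] v_int]|[N [u [-> tE]]]]; last first.
  split; last by move=> i; rewrite lpointE rpredB // intr_nat.
  apply/dilate_DeltaP; rewrite (sum_lpoint R tE).
  split=> [|i]; first by rewrite gerBl.
  rewrite subKr lpointE mulrBr -addrA.
  apply: addr_ge0; first by rewrite -natrM.
  by rewrite -!natrM addrC subr_ge0 ler_nat mulnC leq_divM.
pose z i := Num.floor (v 0 i).
have zE i : v 0 i = (z i)%:~R by rewrite floorK.
have SE : \sum_i v 0 i = (\sum_i z i)%:~R.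
  by rewrite rmorph_sum; apply: eq_bigr.
pose N := absz (t%:Z - \sum_i z i)%R.
have NE : N%:Z = t%:Z - \sum_i z i.
  by rewrite gez0_abs // subr_ge0 -(ler_int R) -SE.
pose f i : nat := ((tnth q i * N) %/ vol q)%N.
have zf_ge0 i : 0 <= z i + (f i)%:Z.
  have := v_ge i; rewrite SE zE.
  have -> : (vol q)%:R * (z i)%:~R + (tnth q i)%:R * (t%:R - (\sum_i z i)%:~R)
     = ((vol q)%:Z * z i + ((tnth q i)%:Z * N%:Z))%:~R :> R.
    by rewrite NE rmorphD !rmorphM rmorphB.
  rewrite ler0z -PoszM (divn_eq (tnth q i * N) (vol q)) -/(f i).
  have : ((tnth q i * N) %% vol q < vol q)%N by rewrite ltn_mod.
  move: (_ %% _)%N (f i) (z i) => a b c; move: (vol q) => V; nia.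
exists N, (fun i => absz (z i + (f i)%:Z)%R); split.
  apply/rowP => i; rewrite lpointE zE -[(absz _)%:R]/((absz _)%:~R) gez0_abs //.
  by rewrite rmorphD addrK.
apply/eqP; rewrite -eqz_nat PoszD (big_morph Posz PoszD (erefl _)); apply/eqP.
rewrite (eq_bigr (fun i => z i + (f i)%:Z)) => [|i _]; last by rewrite gez0_abs.
rewrite big_split /= -(big_morph Posz PoszD (erefl _)) -addrA -PoszD sum_div_wt.
by rewrite NE addrC subrK.
Qed.

Lemma has_dim_Delta (R : realType) n (q : n.-tuple nat) :
  has_dim (Delta R q) n.
Proof.
exists 0, 1%:M; split.
- apply/DeltaP; split=> [|i]; rewrite ?mxE; under eq_bigr do rewrite mxE.
    by rewrite big1.
  by rewrite mulr0 add0r big1 // subr0 mulr1.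
- by rewrite row_free_unit unitmx1.
- move=> i; rewrite add0r rowE mulmx1; apply: sub_conv_hull.
  by left; exists i.
- by move=> v _; rewrite submx1.
Qed.

(** * Consequences of reflexivity and of integer decomposition *)

Lemma reflexive_dvdn (R : realType) n (q : n.-tuple nat) (j : 'I_n) :
  (0 < tnth q j)%N -> reflexive_polytope (Delta R q) -> (tnth q j %| vol q)%N.
Proof.
move=> qj_gt0 [_ _ [V [V_lattice polarE]]].
have qj_neq0 : (tnth q j)%:R != 0 :> R by rewrite pnatr_eq0 -lt0n.
pose T := (\sum_(i | i != j) tnth q i)%N.
(* Since Q = q_j + 1 + T, the j-th coordinate is 1 - Q / q_j. At [w] the polar inequalities of -q
   and of all e_i with i != j are tight. *)
pose w : 'rV[R]_n := \row_i if i == j then - (1 + T%:R) / (tnth q j)%:R else 1.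
have wi i : i != j -> w 0 i = 1 by rewrite mxE => /negbTE ->.
have sum_w : \sum_i (tnth q i)%:R * w 0 i = -1.
  rewrite (bigD1 j) //= mxE eqxx mulrC divfK //.
  under eq_bigr => i ij do rewrite wi // mulr1.
  by rewrite -natr_sum opprD subrK.
have polar_e y i : polar (Delta R q) y -> y 0 i <= 1.
  move=> /(_ (delta_mx 0 i)); rewrite (sum_delta_mx i (fun j => y 0 j)); apply.
  by apply: sub_conv_hull; left; exists i.
have polar_q y : polar (Delta R q) y -> -1 <= \sum_i (tnth q i)%:R * y 0 i.
  pose P (v : 'rV[R]_n) := Delta R q v.
  have : P (\row_i - (tnth q i)%:R).
    apply/DeltaP; under eq_bigr do rewrite mxE.
    rewrite sumrN -natr_sum; split=> [|i].
      by rewrite (@le_trans _ _ 0) // oppr_le0.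
    by rewrite mxE opprK nat1r mulrN addrC mulrC subrr.
  move=> Pq /(_ _ Pq); under eq_bigr do rewrite mxE mulNr.
  by rewrite sumrN lerNl.
have : polar (Delta R q) w.
  move=> v Dv; rewrite -subr_ge0 -sumrN.
  under eq_bigr do rewrite -mulrN.
  apply: (conv_hull_affine_ge0 (a := fun i => - w 0 i)) Dv.
  apply: Delta_vertexP => [i|].
    rewrite (sum_delta_mx i (fun j => - w 0 j)) subr_ge0 mxE.
    case: ifP => // _; rewrite (@le_trans _ _ 0) //.
    by rewrite mulNr oppr_le0 divr_ge0 // nat1r.
  under eq_bigr do rewrite mxE mulrNN.
  by rewrite sum_w subrr.
rewrite polarE => -[k [v [c [Vv c_ge0 c_sum wE]]]].
have vpolar l : polar (Delta R q) (v l).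
  by rewrite polarE; apply: sub_conv_hull.
(* A lattice point [v l] that occurs in [w] with nonzero coefficient must satisfy the same tight
   equalities, which determine its j-th coordinate. *)
have [l cl] : exists l, c l != 0.
  apply: contrapT => /forallNP c0; move: c_sum; rewrite big1 => [/eqP|l _].
    by rewrite eq_sym oner_eq0.
  by apply/eqP/negPn/negP/c0.
have vi i : i != j -> v l 0 i = 1.
  move=> ij; have sum0 : \sum_l c l * (1 - v l 0 i) = 0.
    under eq_bigr do rewrite mulrBr mulr1.
    rewrite sumrB c_sum -(wi i ij) wE summxE.
    by apply/eqP; rewrite subr_eq0; apply/eqP/eq_bigr => l' _; rewrite mxE.
  have /eqP : c l * (1 - v l 0 i) = 0.
    apply: (psumr_eq0P _ sum0) => // l' _.
    by rewrite mulr_ge0 // subr_ge0 polar_e.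
  by rewrite mulf_eq0 (negbTE cl) /= subr_eq0 => /eqP.
have vq : \sum_i (tnth q i)%:R * v l 0 i = -1.
  have sum0 : \sum_l c l * (1 + \sum_i (tnth q i)%:R * v l 0 i) = 0.
    under eq_bigr do rewrite mulrDr mulr1 mulr_sumr.
    rewrite big_split /= c_sum exchange_big /= -[RHS](subrr 1) -sum_w.
    congr (_ + _); apply: eq_bigr => i _; rewrite wE summxE mulr_sumr.
    by apply: eq_bigr => l' _; rewrite mxE mulrCA.
  have /eqP : c l * (1 + \sum_i (tnth q i)%:R * v l 0 i) = 0.
    apply: (psumr_eq0P _ sum0) => // l' _.
    by rewrite mulr_ge0 // -lerBlDl sub0r polar_q.
  by rewrite mulf_eq0 (negbTE cl) /= addrC addr_eq0 => /eqP.
(* Integrality of this coordinate gives q_j z = - (1 + T), so q_j divides 1 + T and therefore Q. *)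
have /intrP [z zE] := V_lattice _ (Vv l) j.
move: vq; rewrite (bigD1 j) //=.
under eq_bigr => i ij do rewrite vi // mulr1.
rewrite -natr_sum -/T zE => /eqP; rewrite -subr_eq0 opprK -addrA natr1.
rewrite !pmulrn -intrM -intrD intr_eq0 => /eqP zT.
rewrite /vol (bigD1 j) //= -/T -addnS dvdn_addr //.
suff : ((tnth q j)%:Z %| T.+1%:Z)%Z by [].
by apply/dvdzP; exists (- z); rewrite mulNr mulrC; move: zT; lia.
Qed.

Lemma IDP_wt (R : realType) n (q : n.-tuple nat) (j : 'I_n) :
  (0 < tnth q j)%N -> (tnth q j %| vol q)%N -> has_IDP (Delta R q) ->
  wt q (vol q %/ tnth q j) = 1%N.
Proof.
move=> qj_gt0 /divnK; set l := (vol q %/ tnth q j)%N => lE [_ idp].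
have l_gt0 : (0 < l)%N by rewrite lt0n; apply: contra_eqN lE => /eqP ->.
have div_l M : ((tnth q j * M) %/ vol q = M %/ l)%N.
  by rewrite -lE [(l * _)%N]mulnC divnMl.
have t_gt0 := wt_gt0 q l_gt0.
have [|v [Pv vE]] := idp (wt q l) (lpoint R q l (fun=> 0%N)) t_gt0.
  by apply/dilate_Delta_latticeP; exists l, (fun=> 0%N); rewrite big1.
have {Pv} /fin_all_exists [N /fin_all_exists [u Nu]] : forall k, exists N u,
    v k = lpoint R q N u /\ (\sum_i u i + wt q N = 1)%N.
  move=> k; apply/dilate_Delta_latticeP; have [Dv ?] := Pv k; split=> //.
  by exists (v k); rewrite ?scale1r.
(* Compare coordinate sums: w(l) - l for the decomposed point, 1 - N_k for each of the w(l)
   summands. *)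
have sumN : (\sum_k N k = l)%N.
  have tE : (\sum_(i < n) (fun=> 0) i + wt q l = wt q l)%N by rewrite big1.
  have := sum_lpoint R tE; rewrite vE.
  have -> : \sum_i (\sum_k v k) 0 i = \sum_k \sum_i v k 0 i.
    by rewrite exchange_big; apply: eq_bigr => i _; rewrite summxE.
  rewrite (eq_bigr (fun k => 1%:R - (N k)%:R)) => [|k _]; last first.
    by rewrite (Nu k).1 (sum_lpoint R (Nu k).2).
  rewrite sumrB sumr_const card_ord => /addrI /oppr_inj /eqP.
  by rewrite -natr_sum eqr_nat => /eqP.
(* If every N_k were below l, the j-th coordinates of the summands would be natural numbers, but
   they add up to -1. *)
have [k Nk] : exists k, (l <= N k)%N.
  apply: contrapT => /forallNP N_lt.
  have : (lpoint R q l (fun=> 0%N)) 0 j < 0.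
    by rewrite lpointE div_l divnn l_gt0 sub0r oppr_lt0.
  rewrite vE summxE ltNge sumr_ge0 // => k _.
  rewrite (Nu k).1 lpointE div_l divn_small ?subr0 //.
  by rewrite ltnNge; apply/negP/N_lt.
have Nk_l : N k = l.
  by apply/eqP; rewrite eqn_leq Nk andbT -sumN (bigD1 k) // leq_addr.
apply/eqP; rewrite eqn_leq t_gt0 andbT -Nk_l -(Nu k).2 leq_addl //.
Qed.

(** * The candidate for h^* and truncated geometric series *)

(** One monomial for each lattice point of the half-open fundamental parallelepiped of the cone over
    [Delta]: these are the points with N = b < Q and u = 0, at height w(b). *)
Definition hstar_poly n (q : n.-tuple nat) : {poly int} :=
  \sum_(b < vol q) 'X^(wt q b).

Lemma coef_hstar_poly n (q : n.-tuple nat) (k : nat) :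
  (hstar_poly q)`_k = \sum_(b < vol q) (wt q b == k)%:R.
Proof. by rewrite coef_sum; apply: eq_bigr => b _; rewrite coefXn eq_sym. Qed.

Lemma size_hstar_poly n (q : n.-tuple nat) : (size (hstar_poly q) <= n.+1)%N.
Proof.
apply/leq_sizeP => k nk; rewrite coef_hstar_poly big1 // => b _.
by rewrite (ltn_eqF (leq_trans (_ : wt q b < n.+1)%N nk)) // ltnS wt_le.
Qed.

(** (1 - X^N)^d is 1 modulo X^N, so the truncated series acts as an inverse of 1 - X below degree N
    and power series can be avoided. *)
Lemma coef_mul_geom (p : {poly int}) (d N k : nat) : (k < N)%N ->
  ((1 - 'X) ^+ d * (p * (\sum_(i < N) 'X^i) ^+ d))`_k = p`_k.
Proof.
move=> kN; have geomE : (1 - 'X) * \sum_(i < N) 'X^i = 1 - 'X^N :> {poly int}.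
  by rewrite -[1 - 'X]opprB mulNr -subrX1 opprB.
rewrite mulrCA -exprMn geomE.
have [g ->] : exists g : {poly int}, (1 - 'X^N) ^+ d = 1 + 'X^N * g.
  elim: d => [|d [g IH]]; first by exists 0; rewrite mulr0 addr0.
  by exists (g - 1 - 'X^N * g); rewrite exprS IH; ring.
by rewrite mulrDr mulr1 coefD mulrCA coefXnM kN addr0.
Qed.

(** * Differences of consecutive coefficients *)

Lemma sum_ord_mul (a d : nat) (F : nat -> int) :
  \sum_(b < (a * d)%N) F b = \sum_(i < a) \sum_(j < d) F (i * d + j)%N.
Proof.
elim: a => [|a IH]; first by rewrite !big_ord0.
by rewrite mulSnr big_split_ord big_ord_recr /= IH.
Qed.

Lemma sum_eq_indicator (n a k : nat) :
  \sum_(i < n) (a + i == k)%N%:R = (a <= k < a + n)%N%:R :> int.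
Proof.
elim: n => [|n IH]; first by rewrite big_ord0; lia.
by rewrite big_ord_recr /= IH; lia.
Qed.

(** The bracket is 1 below min(m, x), 0 from there up to max(m, x), and -1 afterwards. *)
Lemma unimodal_of_diff (h : {poly int}) (c m x : nat) :
  (size h <= (m + x).+1)%N ->
  (forall k, (k < m + x)%N ->
    h`_k.+1 - h`_k = c%:R * ((k < m)%N%:R + (k < x)%N%:R - 1)) ->
  unimodal h.
Proof.
move=> size_h diff; exists (maxn m x) => i i_lt.
have {diff} : h`_i.+1 - h`_i = c%:R * ((i < m)%N%:R + (i < x)%N%:R - 1).
  by apply: diff; lia.
by case: ltnP; case: ltnP => ? ?; rewrite ?(addr0, add0r, subrr, mulr0, addrK);
  split; lia.
Qed.

(** Reading W b = k as W b + 1 = k + 1 puts both indicators at the same value, so that increments of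
    W by 1 telescope. *)
Lemma diff_count (W : nat -> nat) (B k : nat) :
  \sum_(b < B) (W b == k.+1)%:R - \sum_(b < B) (W b == k)%:R
  = \sum_(b < B) ((W b == k.+1)%:R - ((W b).+1 == k.+1)%:R) :> int.
Proof. by rewrite -sumrB. Qed.

(** The sum over j telescopes to its two ends, i = k + 1 and i + x + 1 = k + 1. *)
Lemma diff_rect (m x k : nat) : (k < m + x)%N ->
  \sum_(i < m.+1) \sum_(j < x.+1)
    (((i + j)%N == k.+1)%:R - ((i + j).+1 == k.+1)%:R)
  = (k < m)%N%:R + (k < x)%N%:R - 1 :> int.
Proof.
move=> k_lt.
have inner i : \sum_(j < x.+1) (((i + j)%N == k.+1)%:R - ((i + j).+1 == k.+1)%:R)
    = (0 + i == k.+1)%N%:R - (x.+1 + i == k.+1)%N%:R :> int.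
  under eq_bigr do rewrite -addSn.
  by rewrite sumrB !sum_eq_indicator; lia.
under eq_bigr do rewrite inner.
by rewrite sumrB !sum_eq_indicator; lia.
Qed.

(** Split the range into m blocks of length X and the last index m X. Along a residue class modulo
    X, W grows by 1 from block to block, so the blocks telescope; the last index gives the separate
    term. *)
Lemma telescope_shift (W : nat -> nat) (X m e k : nat) :
  (forall g, W (g + X)%N = (W g).+1) ->
  \sum_(f < (m * X).+1) ((W (e + f)%N == k)%:R - ((W (e + f)%N).+1 == k)%:R)
  = \sum_(f < X) ((W (e + f) == k)%N%:R - (W (e + f) + m == k)%N%:R)
    + ((W e + m == k)%N%:R - ((W e + m).+1 == k)%N%:R) :> int.
Proof.
move=> WX; have Wa a g : W (g + a * X)%N = (W g + a)%N.
  by elim: a => [|a IH]; rewrite ?addn0 // mulSnr addnA WX IH addnS.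
rewrite big_ord_recr /= Wa; congr (_ + _).
rewrite (sum_ord_mul m X
  (fun f => (W (e + f)%N == k)%:R - ((W (e + f)%N).+1 == k)%:R)) exchange_big /=.
apply: eq_bigr => f _; elim: (m) => [|a IH].
  by rewrite big_ord0 addn0 subrr.
rewrite big_ord_recr /= IH.
have -> : (e + (a * X + f) = e + f + a * X)%N by lia.
by rewrite Wa addnS addrA subrK.
Qed.

(** As e + f passes x + 1 at most once, the values run through f, ..., x before and through 1, ...,
    f after the passage. *)
Lemma sum_modn_divn (x j f : nat) : (f < x.+1)%N ->
  \sum_(e < x.+1) ((e + f) %% x.+1 + (e + f) %/ x.+1 == j)%N%:R
  = (f <= j <= x)%N%:R + (0 < j <= f)%N%:R :> int.
Proof.
move=> f_lt.
pose F e : int := ((e + f) %% x.+1 + (e + f) %/ x.+1 == j)%N%:R.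
transitivity (\sum_(e < (x.+1 - f + f)%N) F e).
  by rewrite subnK // ltnW.
rewrite big_split_ord /=.
rewrite (eq_bigr (fun e : 'I_(x.+1 - f) => (f + e == j)%N%:R)) => [|e _].
  rewrite [X in _ + X](eq_bigr (fun e : 'I_f => (1 + e == j)%N%:R)) => [|e _].
    by rewrite !sum_eq_indicator; lia.
  have -> : F (x.+1 - f + e)%N = (((1 * x.+1 + e) %% x.+1 +
      (1 * x.+1 + e) %/ x.+1)%N == j)%:R.
    by rewrite /F mul1n -addnA [(e + f)%N]addnC addnA subnK // ltnW.
  have e_lt : (e < x.+1)%N by apply: ltn_trans f_lt.
  by rewrite modnMDl divnMDl // modn_small // divn_small // addn0 addnC.
have ef_lt : (e + f < x.+1)%N by have := ltn_ord e; lia.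
by rewrite /F modn_small // divn_small // addn0 addnC.
Qed.

(** For 1 <= j <= x the two ranges of [sum_modn_divn] catch j once for every f and once more for f =
    j, in total x + 2 times; j = 0 is caught only by f = 0. *)
Lemma count_modn_divn (x j : nat) :
  \sum_(e < x.+1) \sum_(f < x.+1)
    ((e + f) %% x.+1 + (e + f) %/ x.+1 == j)%N%:R
  = x.+2%:R * (0 < j <= x)%N%:R + (j == 0%N)%:R :> int.
Proof.
rewrite exchange_big /=; under eq_bigr => f _ do rewrite sum_modn_divn //.
rewrite (eq_bigr (fun f : 'I_x.+1 => (0 < j <= x)%N%:R +
  ((0 < j <= x)%N%:R * (0 + f == j)%N%:R
   + (j == 0%N)%:R * (0 + f == 0)%N%:R) : int)) => [|f _].
  rewrite big_split sumr_const card_ord big_split /= -!mulr_sumr.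
  by rewrite !sum_eq_indicator -mulr_natr; lia.
by have := ltn_ord f; lia.
Qed.

(** With C(j) the count of [count_modn_divn], telescoping leaves C(k + 1) - C(k + 1 - m) and end
    terms. The latter reduce to [k + 1 = m], which cancels the contribution of C(0). *)
Lemma diff_modn_divn (m x k : nat) : (k < m + x)%N ->
  \sum_(e < x.+1) \sum_(f < (m * x.+1).+1)
    (((e + f) %% x.+1 + (e + f) %/ x.+1 == k.+1)%N%:R
     - (((e + f) %% x.+1 + (e + f) %/ x.+1).+1 == k.+1)%N%:R)
  = x.+2%:R * ((k < m)%N%:R + (k < x)%N%:R - 1) :> int.
Proof.
move=> k_lt; pose W g := (g %% x.+1 + g %/ x.+1)%N.
have WX g : W (g + x.+1)%N = (W g).+1.
  by rewrite /W modnDr divnDr // divnn addn1 addnS.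
have WE e : (e < x.+1)%N -> W e = e.
  by move=> e_lt; rewrite /W modn_small // divn_small // addn0.
under eq_bigr => e _ do rewrite (telescope_shift m e k.+1 WX) WE //.
rewrite big_split /=.
under eq_bigr do rewrite sumrB.
rewrite !sumrB count_modn_divn.
(* The factor [m <= k + 1] guards the truncated subtraction k + 1 - m. *)
have -> : \sum_(e < x.+1) \sum_(f < x.+1) (W (e + f) + m == k.+1)%N%:R =
   (m <= k.+1)%N%:R *
     (x.+2%:R * (0 < k.+1 - m <= x)%N%:R + ((k.+1 - m)%N == 0%N)%:R) :> int.
  rewrite -count_modn_divn mulr_sumr; apply: eq_bigr => e _.
  rewrite mulr_sumr; apply: eq_bigr => f _; rewrite -/(W (e + f)%N).
  by case: (leqP m k.+1); rewrite ?mul1r ?mul0r; move: (W _) => g; lia.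
have -> : \sum_(e < x.+1) (e + m == k.+1)%N%:R = (m <= k.+1 < m + x.+1)%N%:R :> int.
  by rewrite -sum_eq_indicator; apply: eq_bigr => e _; rewrite addnC.
have -> : \sum_(e < x.+1) ((e + m).+1 == k.+1)%N%:R =
    (m.+1 <= k.+1 < m.+1 + x.+1)%N%:R :> int.
  by rewrite -sum_eq_indicator; apply: eq_bigr => e _; rewrite addSn addnC.
have -> : (0 < k.+1 - m <= x)%N = (m <= k)%N by lia.
have -> : (0 < k.+1 <= x)%N = (k < x)%N by lia.
by case: (ltnP k x) => ?; case: (leqP m k) => ?;
  rewrite ?(mulr1, mulr0, addr0, add0r); lia.
Qed.

(** * Ehrhart counts and identification of h^* *)

Lemma coef_mul_geom_card n (q : n.-tuple nat) (N t : nat) :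
  (hstar_poly q * (\sum_(i < N) 'X^i) ^+ n.+1)`_t =
  #|[set p : 'I_(vol q) * {ffun 'I_n.+1 -> 'I_N} |
      (wt q p.1 + \sum_i p.2 i)%N == t]%SET|%:Z.
Proof.
have -> : (\sum_(i < N) 'X^i) ^+ n.+1 =
    \sum_(f : {ffun 'I_n.+1 -> 'I_N}) 'X^(\sum_i f i) :> {poly int}.
  rewrite -[in LHS](card_ord n.+1) -prodr_const bigA_distr_bigA /=.
  by apply: eq_bigr => f _; rewrite prodrXr.
rewrite /hstar_poly mulr_suml coef_sum.
under eq_bigr do rewrite mulr_sumr coef_sum.
rewrite pair_big /= -natz -sum1_card natr_sum [RHS]big_mkcond /=.
apply: eq_bigr => p _; rewrite -exprD coefXn finset.inE eq_sym.
by case: eqP.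
Qed.

(** The bijection [phi] sends (b, f) to the lattice point with N = f_0 Q + b and u given by the
    other entries of f; by [wt_vol_add] its height is w(b) + \sum_i f_i. *)
Lemma ehrhart_Delta (R : realType) n (q : n.-tuple nat) (N t : nat) :
  (t < N)%N ->
  (ehrhart (Delta R q) t)%:Z = (hstar_poly q * (\sum_(i < N) 'X^i) ^+ n.+1)`_t.
Proof.
case: N => // N; rewrite ltnS => t_le; rewrite coef_mul_geom_card; congr Posz.
pose D := [set p : 'I_(vol q) * {ffun 'I_n.+1 -> 'I_N.+1} |
  (wt q p.1 + \sum_i p.2 i)%N == t]%SET.
pose M (p : 'I_(vol q) * {ffun 'I_n.+1 -> 'I_N.+1}) :=
  (p.2 ord0 * vol q + p.1)%N.
pose U (p : 'I_(vol q) * {ffun 'I_n.+1 -> 'I_N.+1}) i : nat :=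
  p.2 (lift ord0 i).
pose phi p := lpoint R q (M p) (U p).
have MU p : p \in D -> (\sum_i U p i + wt q (M p) = t)%N.
  rewrite finset.inE big_ord_recl => /eqP <-.
  by rewrite wt_vol_add addnC [in RHS]addnC addnAC.
(* The coordinate sum t - N recovers N, division by Q recovers b and f_0, and the coordinates then
   give u. *)
have phi_inj : {in D &, injective phi}.
  move=> [b f] [b' f'] Dp Dp' eq_phi.
  have /eqP : \sum_i phi (b, f) 0 i = \sum_i phi (b', f') 0 i by rewrite eq_phi.
  rewrite (sum_lpoint R (MU _ Dp)) (sum_lpoint R (MU _ Dp')).
  rewrite (inj_eq (addrI _)) eqr_opp eqr_nat => /eqP eq_M.
  have eq_b : b = b'.
    apply: val_inj; rewrite /= -(modn_small (ltn_ord b)).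
    rewrite -(modn_small (ltn_ord b')) -(modnMDl (f ord0) b).
    by rewrite -(modnMDl (f' ord0) b') [X in (X %% _)%N]eq_M.
  congr (_, _) => //; apply/ffunP => i; apply: val_inj => /=.
  have [j ->|->] := unliftP ord0 i.
    have := congr1 (fun v : 'rV[R]_n => v 0 j) eq_phi.
    by rewrite /phi !lpointE eq_M => /addIr/eqP; rewrite eqr_nat => /eqP.
  move: eq_M; rewrite /M /= eq_b => /addIn/eqP.
  by rewrite eqn_pmul2r // => /eqP.
rewrite /ehrhart.
(* Finiteness, shown here too, excludes the default value of [fset_set]. *)
have -> : dilate t (Delta R q) `&` lattice (R := R) (n := n) =
    [set` [fset v in [seq phi p | p in D]]%fset].
  apply/seteqP; split=> [v /dilate_Delta_latticeP [K [u [-> tE]]]|v /=].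
    rewrite /= inE; apply/fintype.imageP.
    have KE : K = (K %/ vol q * vol q + K %% vol q)%N by apply: divn_eq.
    have wtK : wt q K = (K %/ vol q + wt q (K %% vol q))%N.
      by rewrite {1}KE wt_vol_add.
    have u_le i : (u i <= N)%N.
      by apply: leq_trans t_le; rewrite -tE (bigD1 i) //= -addnA leq_addr.
    (* Both bounds, on u and on K / Q, ensure that [inord] below returns the intended values. *)
    have K_le : (K %/ vol q <= N)%N by lia.
    pose p := (Ordinal (ltn_pmod K (ltn0Sn _)) : 'I_(vol q),
      [ffun i => inord (if unlift ord0 i is Some j then u j else K %/ vol q)]
      : {ffun 'I_n.+1 -> 'I_N.+1}).
    have p0 : p.2 ord0 = (K %/ vol q)%N :> nat.
      by rewrite ffunE unlift_none inordK ?ltnS.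
    have pS i : p.2 (lift ord0 i) = u i :> nat.
      by rewrite ffunE liftK inordK ?ltnS.
    exists p.
      rewrite finset.inE big_ord_recl p0 (eq_bigr _ (fun i _ => pS i)) /=.
      by rewrite -tE wtK addnCA addnA addnC.
    rewrite /phi /M p0 /= -KE; apply/rowP => i.
    by rewrite !lpointE /U pS.
  rewrite inE => /fintype.imageP [p Dp ->].
  by apply/dilate_Delta_latticeP; exists (M p), (U p); rewrite MU.
rewrite set_fsetK card_fseq undup_id ?size_map -?cardE //.
by rewrite map_inj_in_uniq ?enum_uniq // => p p'; rewrite !mem_enum; apply: phi_inj.
Qed.

(** Coefficient k involves only dilates t <= k, so truncation at k + 1 suffices. *)
Lemma is_hstar_Delta (R : realType) n (q : n.-tuple nat) :
  is_hstar (Delta R q) (hstar_poly q).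
Proof.
exists n; split; [exact: has_dim_Delta|exact: size_hstar_poly|move=> k].
rewrite -(@coef_mul_geom _ n.+1 k.+1 k (ltnSn k)) coefM.
apply: eq_bigr => i _; rewrite (@ehrhart_Delta R _ _ k.+1) // ltnS.
by rewrite leq_subr.
Qed.

(** * The case of two distinct weights *)

Lemma sum_two_blocks (r s m x : nat) (F : nat -> nat) :
  (\sum_i F (tnth (cat_tuple (nseq_tuple m r) (nseq_tuple x s)) i)
    = m * F r + x * F s)%N.
Proof.
rewrite -(big_tuple _ _ _ predT) /= big_cat /= !big_nseq.
by rewrite !iter_addn_0 ![(F _ * _)%N]mulnC.
Qed.

Lemma tnth_two_blocks (r s m x : nat) (m_gt0 : (0 < m)%N) (x_gt0 : (0 < x)%N) :
  let q := cat_tuple (nseq_tuple m r) (nseq_tuple x s) in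
  (exists i, tnth q i = r) /\ (exists i, tnth q i = s).
Proof.
move=> q; split.
  by exists (lshift x (Ordinal m_gt0)); rewrite tnth_lshift tnth_nseq.
by exists (rshift m (Ordinal x_gt0)); rewrite tnth_rshift tnth_nseq.
Qed.

Lemma two_blocks_arith (R : realType) (r s m x : nat) :
  (0 < r)%N -> (r < s)%N -> (0 < m)%N -> (0 < x)%N ->
  let q := cat_tuple (nseq_tuple m r) (nseq_tuple x s) in
  reflexive_polytope (Delta R q) -> has_IDP (Delta R q) ->
  s = (m * r).+1 /\ (r = 1%N \/ r = x.+1).
Proof.
move=> r_gt0 r_lt_s m_gt0 x_gt0 q refl idp.
have s_gt0 : (0 < s)%N by apply: ltn_trans r_lt_s.
have volE : vol q = (m * r + x * s).+1 by rewrite /vol (sum_two_blocks r s m x id).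
(* With Q = q_i l one has floor(q_j l / Q) = floor(q_j / q_i), so w(l) = 1 reads l = 1 + \sum_j
   floor(q_j / q_i). *)
have key i : (0 < tnth q i)%N ->
    (vol q = tnth q i * (1 + (m * (r %/ tnth q i) + x * (s %/ tnth q i))))%N.
  move=> qi_gt0; have dvd := reflexive_dvdn qi_gt0 refl.
  have qil := divnK dvd; set l := (vol q %/ tnth q i)%N in qil.
  have l_gt0 : (0 < l)%N by rewrite lt0n; apply: contra_eqN qil => /eqP ->.
  have := sum_div_wt q l; rewrite (IDP_wt qi_gt0 dvd idp).
  under eq_bigr do rewrite -qil [(l * _)%N]mulnC divnMr //.
  by rewrite (sum_two_blocks r s m x (fun a => a %/ tnth q i)%N) -qil => <-; lia.
have [[i ri] [j sj]] := tnth_two_blocks r s m_gt0 x_gt0.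
(* For q_j = s this is m r + x s + 1 = s (1 + x). *)
have := key j; rewrite sj => /(_ s_gt0).
rewrite divn_small // divnn s_gt0 volE => sE.
have {}sE : s = (m * r).+1 by nia.
split=> //; have := key i; rewrite ri => /(_ r_gt0).
(* If r > 1 the floor is m, and the equation for r reduces to x + 1 = r. *)
have -> : (s %/ r = m + 1 %/ r)%N by rewrite sE -addn1 divnMDl.
rewrite divnn r_gt0 volE sE; case: (r =P 1%N) => [|r_neq1]; first by left.
by rewrite [(1 %/ r)%N]divn_small => [?|]; [right|]; nia.
Qed.

(** Here Q = (m + 1)(x + 1). For b = i (x + 1) + j the floors are 0 for the weight 1 and i for m +
    1, so w(b) = b - x i = i + j. *)
Lemma unimodal_hstar_r_eq1 (m x : nat) :
  unimodal (hstar_poly (cat_tuple (nseq_tuple m 1) (nseq_tuple x m.+1))).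
Proof.
set q := cat_tuple _ _.
have volE : vol q = (m.+1 * x.+1)%N.
  by rewrite /vol (sum_two_blocks 1 m.+1 m x id); lia.
have wtE (i : 'I_m.+1) (j : 'I_x.+1) : wt q (i * x.+1 + j) = (i + j)%N.
  have b_lt : (i * x.+1 + j < vol q)%N.
    by rewrite volE; have := ltn_ord i; have := ltn_ord j; nia.
  rewrite /wt (sum_two_blocks 1 m.+1 m x
    (fun a => a * (i * x.+1 + j) %/ vol q)%N).
  rewrite mul1n divn_small // volE divnMl // divnMDl // divn_small //; lia.
apply: (@unimodal_of_diff _ 1 m x) => [|k k_lt]; first exact: size_hstar_poly.
rewrite !coef_hstar_poly diff_count volE.
rewrite (sum_ord_mul _ _ (fun b => (wt q b == k.+1)%:R - ((wt q b).+1 == k.+1)%:R)).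
rewrite mul1r -diff_rect //.
by apply: eq_bigr => i _; apply: eq_bigr => j _; rewrite wtE.
Qed.

(** Here Q = (x + 1) s. For b = e s + f the floors are e for the weight x + 1 and floor(b / (x + 1))
    = m e + floor((e + f) / (x + 1)) for s, so w(b) is the remainder plus the quotient of e + f by x
    + 1. *)
Lemma unimodal_hstar_r_gt1 (m x : nat) :
  unimodal (hstar_poly
    (cat_tuple (nseq_tuple m x.+1) (nseq_tuple x (m * x.+1).+1))).
Proof.
set s := (m * x.+1).+1; set q := cat_tuple _ _.
have volE : vol q = (x.+1 * s)%N.
  by rewrite /vol (sum_two_blocks x.+1 s m x id) /s; nia.
have wtE (e : 'I_x.+1) (f : 'I_s) :
    wt q (e * s + f) = ((e + f) %% x.+1 + (e + f) %/ x.+1)%N.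
  rewrite /wt (sum_two_blocks x.+1 s m x (fun a => a * (e * s + f) %/ vol q)%N).
  rewrite {1}volE divnMl // divnMDl // [(f %/ s)%N]divn_small // addn0.
  rewrite volE [(x.+1 * s)%N]mulnC divnMl //.
  have bE : (e * s + f = (m * e) * x.+1 + (e + f))%N by rewrite /s; nia.
  rewrite bE divnMDl //.
  have := divn_eq (e + f) x.+1; nia.
apply: (@unimodal_of_diff _ x.+2 m x) => [|k k_lt]; first exact: size_hstar_poly.
rewrite !coef_hstar_poly diff_count volE.
rewrite (sum_ord_mul _ _ (fun b => (wt q b == k.+1)%:R - ((wt q b).+1 == k.+1)%:R)).
rewrite -diff_modn_divn //.
by apply: eq_bigr => e _; apply: eq_bigr => f _; rewrite wtE.
Qed.

Local Close Scope ring_scope.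
Local Close Scope classical_set_scope.

Theorem theorem4p2 (R : realType) (r s m x : nat)
    (r_gt0 : (0 < r)%N) (r_lt_s : (r < s)%N)
    (m_gt0 : (0 < m)%N) (x_gt0 : (0 < x)%N)
    (q : (m + x).-tuple nat)
    (qE : q = cat_tuple (nseq_tuple m r) (nseq_tuple x s))
    (Delta_reflexive : reflexive_polytope (Delta R q))
    (Delta_IDP : has_IDP (Delta R q)) :
  exists h : {poly int}, is_hstar (Delta R q) h /\ unimodal h.
Proof.
exists (hstar_poly q); split; first exact: is_hstar_Delta.
subst q; have [-> [->|->]] :=
  two_blocks_arith r_gt0 r_lt_s m_gt0 x_gt0 Delta_reflexive Delta_IDP.
- by rewrite muln1; apply: unimodal_hstar_r_eq1.
- exact: unimodal_hstar_r_gt1.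
Qed.
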